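(* Let $(W,S)$ be a Coxeter system, with $W$ ordered by the (left) weak order. Let $u,w\in W$ with $u\le w$ and let $K=D_R(wu^{-1})$. Suppose that $K_1,K_2,\dots,K_r$ are the subsets of $K$ such that each $K_i$ is a connected component of the Coxeter graph for $(W_K,K)$ and $\bigcup_{i=1}^r K_i=K$. Then the characteristic polynomial of the interval $[u,w]$ is given by \[ \chi_{[u,w]}(q)=q^{\ell(wu^{-1})-\ell(w_0(K))}\chi_{K_1}(q)\chi_{K_2}(q)\cdots\chi_{K_r}(q). \]
   Context: A Coxeter system $(W,S)$ has a (possibly infinite) group $W$ with generators $S$ and relations $(ss')^{m(s,s')}=e$, where $m(s,s)=1$ and $m(s,s')=m(s',s)\in\{2,3,\dots,\infty\}$ for $s\ne s'$. Its Coxeter graph has vertex set $S$, with $s,s'$ joined by an edge iff $m(s,s')\ge3$. $\ell(w)$ is the minimal number of generators in an expression of $w$. $D_R(w)=\{s\in S:\ell(ws)<\ell(w)\}$. For $J\subseteq S$, $W_J$ is the subgroup generated by $J$; $(W_J,J)$ is a Coxeter system, ordered by its own left weak order. If $W_J$ is finite, $w_0(J)$ denotes the top element of $W_J$. (For $K=D_R(wu^{-1})$ the group $W_K$ is finite.) The (left) weak order: $u\le w$ if $w=s_k\cdots s_1u$ for some $s_j\in S$ with $\ell(s_j\cdots s_1u)=\ell(u)+j$ for $0\le j\le k$. Intervals are $[u,w]=\{t\in W:u\le t\le w\}$; each is a finite ranked poset with rank function $t\mapsto \ell(t)-\ell(u)$. For a finite ranked poset $P$ with bottom element $\hat 0$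 (all maximal chains have the same length, where a chain with $m+1$ elements has length $m$), let $r_P$ be the rank function, let $r_P(P)$ be the length of a maximal chain, and let $\mu_P$ be the Möbius function, defined by $\sum_{x\le t\le y}\mu_P(x,t)=\delta_{x,y}$ for all $x\le y$. The characteristic polynomial is $\chi_P(q)=\sum_{t\in P}\mu_P(\hat 0,t)\,q^{r_P(P)-r_P(t)}$. For $J\subseteq S$ with $W_J$ finite, $\chi_J$ denotes $\chi_{W_J}$. *)

(* Defs.v *)
From Stdlib Require Import Relation_Operators.
From mathcomp Require Import all_boot all_order all_algebra.
From mathcomp Require Import all_classical.

Set Implicit Arguments.
Unset Strict Implicit.
Unset Printing Implicit Defensive.

Local Open Scope classical_set_scope.

Section Presentation.
Context {W : groupType}.

Definition subgroup_gen (A : set W) : set W :=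
  smallest (fun H : set W => group_closed (mem H)) A.

(* Words representing elements of the free group on S; the letter (s, b) is s
   if b = false and the formal inverse of s if b = true. *)
Definition signed_word : Type := seq (W * bool).

Definition word_val (a : signed_word) : W :=
  (\prod_(x <- a) (if x.2 then x.1^-1 else x.1))%g.

(* a and b represent the same element of the quotient of the free group on S by
   the normal closure of the relators R. *)
Inductive word_equiv (S : set W) (R : set signed_word) :
    signed_word -> signed_word -> Prop :=
| word_equiv_refl a : word_equiv S R a a
| word_equiv_sym a b : word_equiv S R a b -> word_equiv S R b a
| word_equiv_trans a b c :
    word_equiv S R a b -> word_equiv S R b c -> word_equiv S R a c
| word_equiv_cancel a b s e :
    S s -> word_equiv S R (a ++ [:: (s, e); (s, ~~ e)] ++ b) (a ++ b)
| word_equiv_relator a b p :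
    R p -> word_equiv S R (a ++ p ++ b) (a ++ b).

Definition presented_by (S : set W) (R : set signed_word) : Prop :=
  subgroup_gen S = setT /\
  forall a : signed_word, (forall x, x \in a -> S x.1) ->
    (word_val a = 1%g <-> word_equiv S R a [::]).

End Presentation.

Section Coxeter.
Context {W : groupType}.

(* m s t = None encodes m(s, t) = oo; only the values on S matter. *)
Definition coxeter_relators (S : set W) (m : W -> W -> option nat) :
    set signed_word :=
  [set p | exists s t k, [/\ S s, S t, m s t = Some k &
     p = flatten (nseq k [:: (s, false); (t, false)])]].

Record coxeter_system (S : set W) (m : W -> W -> option nat) : Prop := {
  coxeter_diag : forall s, S s -> m s s = Some 1%N;
  coxeter_sym : forall s t, S s -> S t -> m s t = m t s;
  coxeter_ge2 : forall s t k,
    S s -> S t -> s <> t -> m s t = Some k -> (2 <= k)%N;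
  coxeter_presentation : presented_by S (coxeter_relators S m)
}.

(* The notions below are relative to a set J of generators: J = S gives those
   of (W, S), while J proper gives those of the Coxeter system (W_J, J). *)

Definition is_expression (J : set W) (w : W) (s : seq W) : Prop :=
  (forall x, x \in s -> J x) /\ (\prod_(x <- s) x)%g = w.

(* The default 0 is irrelevant for w in W_J when J consists of involutions. *)
Definition length (J : set W) (w : W) : nat :=
  xget 0%N [set n | (exists2 s, is_expression J w s & size s = n) /\
                    forall s, is_expression J w s -> (n <= size s)%N].

Definition right_descents (J : set W) (w : W) : set W :=
  [set s | J s /\ (length J (w * s)%g < length J w)%N].

(* s lists s_1, ..., s_k, so that the product over rev (take j s) is
   s_j ... s_1. *)
Definition weak_le (J : set W) (u w : W) : Prop :=
  exists s : seq W,
    [/\ forall x, x \in s -> J x,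
        w = ((\prod_(x <- rev s) x) * u)%g &
        forall j, (j <= size s)%N ->
          length J ((\prod_(x <- rev (take j s)) x) * u)%g
            = (length J u + j)%N].

Definition weak_interval (J : set W) (u w : W) : set W :=
  [set t | weak_le J u t /\ weak_le J t w].

(* The element w_0(J); meaningful when W_J is finite. *)
Definition top_element (J : set W) : W :=
  xget 1%g [set x | subgroup_gen J x /\
                    forall y, subgroup_gen J y -> weak_le J y x].

Definition coxeter_edge (m : W -> W -> option nat) (K : set W) (s t : W) :
    Prop :=
  [/\ K s, K t, s <> t & if m s t is Some k then (3 <= k)%N else True].

Definition is_component (m : W -> W -> option nat) (K C : set W) : Prop :=
  exists2 s, K s & C = [set t | clos_refl_trans W (coxeter_edge m K) s t].

End Coxeter.

(* A poset is given by a relation le and a carrier set P. *)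
Section RankedPoset.
Context {T : choiceType}.
Variables (le : T -> T -> Prop).

Definition is_chain (P C : set T) : Prop := C `<=` P /\ total_on C le.

Definition is_maximal_chain (P C : set T) : Prop :=
  is_chain P C /\ forall D, is_chain P D -> C `<=` D -> D = C.

(* The length of a maximal chain of P; independent of the chain when P is
   finite and ranked. *)
Definition poset_rank (P : set T) : nat :=
  xget 0%N [set n | exists2 C, is_maximal_chain P C & (C #= `I_n.+1)%card].

Definition rank (P : set T) (t : T) : nat :=
  poset_rank [set x | P x /\ le x t].

Definition is_mobius (P : set T) (mu : T -> T -> int) : Prop :=
  forall x y, P x -> P y -> le x y ->
    (\sum_(t \in [set t | [/\ P t, le x t & le t y]]) mu x t
       = (x == y)%:R)%R.

(* For P finite, is_mobius determines mu x y whenever x <= y in P. *)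
Definition mobius (P : set T) (x y : T) : int :=
  xget 0%R [set v | exists2 mu, is_mobius P mu & mu x y = v].

(* bot is the bottom element of P. *)
Definition characteristic_poly (P : set T) (bot : T) : {poly int} :=
  (\sum_(t \in P) mobius P bot t *: 'X^(poset_rank P - rank P t))%R.

End RankedPoset.

Section CharacteristicPolynomials.
Context {W : groupType}.

Definition chi_interval (S : set W) (u w : W) : {poly int} :=
  characteristic_poly (weak_le S) (weak_interval S u w) u.

Definition chi_parabolic (J : set W) : {poly int} :=
  characteristic_poly (weak_le J) (subgroup_gen J) 1%g.

End CharacteristicPolynomials.

(* Main.v *)
From Stdlib Require Import Relation_Operators.
Require Import Defs.
From mathcomp Require Import all_boot all_order all_algebra.
From mathcomp Require Import finmap.
From mathcomp Require Import all_classical.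
From mathcomp Require Import zify.

Set Implicit Arguments.
Unset Strict Implicit.
Unset Printing Implicit Defensive.

Import GRing.Theory.
Local Open Scope classical_set_scope.
Local Open Scope group_scope.

(** Write v for w u^-1 and D(x) for the set of right descents of x. Right
translation by u^-1 identifies the interval [u, w] with [1, v], and the proof
computes the Moebius function of the weak order from the bottom: mu(1, x) is
(-1)^|J| when x is the top element w_0(J) of a finite parabolic subgroup W_J,
and 0 otherwise. The reason is that if J is contained in D(y), then every
element of W_J lies below y ([descents_weak_le]): W_J then has a top element,
and the w_0(J) below y correspond to the subsets J of D(y) ([sum_weak_le]).
Hence the sum of mu(1, x) over x <= y is the sum of (-1)^|J| over the subsets
of D(y), which vanishes unless D(y) is empty, that is, unless y = 1.

Consequently the characteristic polynomial of [u, w] is the sum over the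
subsets J of K = D(v) of (-1)^|J| q^(l(v) - l(w_0(J))) ([chi_interval_sum]).
The set W_J itself is the interval from 1 to w_0(J), so chi_J is given by the
same formula with v replaced by w_0(J). Factoring out q^(l(v) - l(w_0(K)))
leaves chi_K. If K splits into two disjoint commuting parts A and B, then
l(ab) = l(a) + l(b) for a in W_A and b in W_B ([length_mul_disjoint]). So the
length of the top element is additive on unions of a subset of A and a subset
of B, and the sum over the subsets of K factors ([chi_descentsU]). Distinct
components of the Coxeter graph commute, which gives the product over the
components.

The Coxeter-theoretic input is the exchange condition. It is derived from the
presentation by counting, for a word s_1 ... s_n and an element t, the parity of
the number of indices i with s_1 ... s_(i-1) s_i s_(i-1)^-1 ... s_1^-1 = t. This
parity is unchanged by cancellations and by the relators (st)^m, so it depends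
only on the element represented ([coxeter_word_invariants]). *)

(** * Words and their reflections *)

Section Words.
Context {W : groupType}.
Implicit Types (a b : seq W) (s t x y w : W).

Definition wprod a : W := \prod_(x <- a) x.

Lemma wprod_nil : wprod [::] = 1. Proof. exact: big_nil. Qed.
Lemma wprod_cons x a : wprod (x :: a) = x * wprod a.
Proof. exact: big_cons. Qed.
Lemma wprod_cat a b : wprod (a ++ b) = wprod a * wprod b.
Proof. exact: big_cat. Qed.
Lemma wprod_rcons a x : wprod (rcons a x) = wprod a * x.
Proof. by rewrite -cats1 wprod_cat wprod_cons wprod_nil mulg1. Qed.

Lemma wprod_rev a : (forall x, x \in a -> x * x = 1) ->
  wprod (rev a) = (wprod a)^-1.
Proof.
elim: a => [|x a IH] inv_a; first by rewrite wprod_nil invg1.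
rewrite rev_cons wprod_rcons wprod_cons invgM IH; last first.
  by move=> y ya; apply: inv_a; rewrite inE ya orbT.
congr (_ * _); apply: (mulgI x).
by rewrite mulgV inv_a // mem_head.
Qed.

(** The elements p x p^-1 where x is a letter of a and p is the product of the
letters before it. If all letters are involutions, these are the elements whose
left multiplication deletes a letter from the word. *)
Fixpoint refls a : seq W :=
  if a is x :: a' then x :: [seq x * y * x^-1 | y <- refls a'] else [::].

Lemma refls_cat a b :
  refls (a ++ b) = refls a ++ [seq wprod a * y * (wprod a)^-1 | y <- refls b].
Proof.
elim: a => [|x a IH] /=.
  by rewrite wprod_nil; elim: (refls b) => //= y r <-; rewrite mul1g invg1 mulg1.
rewrite IH map_cat -map_comp; congr (_ :: _ ++ _); apply: eq_map => y /=.
by rewrite wprod_cons invgM !mulgA.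
Qed.


Lemma refls_split a y : y \in refls a ->
  exists a1 x a2, a = a1 ++ x :: a2 /\ y = wprod a1 * x * (wprod a1)^-1.
Proof.
elim: a y => [|x a IH] y //=; rewrite inE => /orP[/eqP ->|/mapP[z /IH]].
  by exists [::], x, a; rewrite wprod_nil invg1 mulg1 mul1g.
move=> [a1 [x' [a2 [-> ->]]]] ->; exists (x :: a1), x', a2; split=> //.
by rewrite wprod_cons invgM !mulgA.
Qed.

(** Multiplying on the left by p x p^-1 turns the prefix p x into p x x = p. *)
Lemma wprod_delete a y : (forall x, x \in a -> x * x = 1) -> y \in refls a ->
  exists a1 x a2, a = a1 ++ x :: a2 /\ y * wprod a = wprod (a1 ++ a2).
Proof.
move=> inv_a /refls_split[a1 [x [a2 [def_a ->]]]]; exists a1, x, a2; split=> //.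
rewrite def_a !wprod_cat wprod_cons mulgA mulgVK -!mulgA.
by rewrite (mulgA x) inv_a ?mul1g // def_a mem_cat mem_head orbT.
Qed.

Definition refl_parity a t : bool := odd (count_mem t (refls a)).

Lemma refl_parity_cat a b t :
  refl_parity (a ++ b) t =
    refl_parity a t (+) refl_parity b ((wprod a)^-1 * t * wprod a).
Proof.
rewrite /refl_parity refls_cat count_cat oddD count_map; congr (_ (+) odd _).
apply: eq_count => y /=; apply/eqP/eqP => [<-|->].
  by rewrite !mulgA mulVg mul1g mulgVK.
by rewrite !mulgA mulgV mul1g mulgK.
Qed.

(** In the dihedral group generated by s and t, conjugating (st)^j s by st
multiplies it by (st)^2 on the left. *)
Lemma refls_alternating s t k : s * s = 1 -> t * t = 1 ->
  refls (flatten (nseq k [:: s; t])) = [seq (s * t) ^+ j * s | j <- iota 0 k.*2].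
Proof.
move=> ss tt; have sV : s^-1 = s by apply: (mulgI s); rewrite mulgV ss.
have tV : t^-1 = t by apply: (mulgI t); rewrite mulgV tt.
elim: k => [|k IH] //=; rewrite IH expg0 mul1g expg1 sV; congr [:: _, _ & _].
rewrite (iotaDl 2 0) -!map_comp; apply: eq_map => j /=.
by rewrite tV add2n expgS expgSr !mulgA.
Qed.

(** If (st)^k = 1, then the 2k reflections (st)^j s of the relator have period k
in j, so each value occurs an even number of times. *)
Lemma refl_parity_relator s t k r :
    s * s = 1 -> t * t = 1 -> (s * t) ^+ k = 1 ->
  refl_parity (flatten (nseq k [:: s; t])) r = false.
Proof.
move=> ss tt stk; rewrite /refl_parity refls_alternating // -addnn iotaD.
have -> : iota (0 + k) k = map (addn k) (iota 0 k) by rewrite -iotaDl addn0.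
rewrite map_cat count_cat -map_comp.
have -> : [seq ((fun j => (s * t) ^+ j * s) \o addn k) j | j <- iota 0 k]
    = [seq (s * t) ^+ j * s | j <- iota 0 k].
  by apply: eq_map => j /=; rewrite expgnDr stk mul1g.
by rewrite addnn odd_double.
Qed.

Lemma wprod_alternating s t k : wprod (flatten (nseq k [:: s; t])) = (s * t) ^+ k.
Proof.
elim: k => [|k IH] /=; first exact: wprod_nil.
by rewrite !wprod_cons IH expgS mulgA.
Qed.

End Words.

(** * Invariance of the parities under the presentation *)

Section ParityInvariance.
Context {W : groupType}.
Variables (S : set W) (R : set (signed_word (W := W))).

(** A formal inverse is replaced by the inverse in the group; for generators,
which are involutions, this forgets the sign. *)
Definition unsign (a : seq (W * bool)) : seq W :=
  [seq if x.2 then x.1^-1 else x.1 | x <- a].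

Lemma word_valE a : word_val a = wprod (unsign a).
Proof. by rewrite /word_val /wprod big_map. Qed.

Hypothesis S_inv : forall s, S s -> s * s = 1.
Hypothesis R_trivial : forall p, R p -> wprod (unsign p) = 1 /\
  (forall t, refl_parity (unsign p) t = false) /\ ~~ odd (size p).

Lemma word_equiv_invariants a b : word_equiv S R a b ->
  [/\ wprod (unsign a) = wprod (unsign b),
      refl_parity (unsign a) =1 refl_parity (unsign b) &
      odd (size a) = odd (size b)].
Proof.
elim=> {a b} [a|a b _ [-> IH ->]|a b c _ [-> IH1 ->] _ [-> IH2 ->]|
              a b s e Ss|a b p /R_trivial[p1 [pN p_even]]].
- by split.
- by split=> // t; rewrite IH.
- by split=> // t; rewrite IH1 IH2.
- have sV : s^-1 = s by apply: (mulgI s); rewrite mulgV S_inv.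
  rewrite /unsign !map_cat -/(unsign a) -/(unsign b) /= sV !if_same.
  split; last by rewrite !size_cat /= !oddD /= negbK.
    by rewrite !wprod_cat !wprod_cons (mulgA s) S_inv // mul1g.
  move=> t; rewrite 2!(refl_parity_cat (unsign a)).
  rewrite (refl_parity_cat [:: s; s] (unsign b)).
  rewrite !wprod_cons wprod_nil mulg1 S_inv // invg1 mulg1 mul1g.
  by rewrite /refl_parity /= sV S_inv // mul1g addn0 addnn odd_double.
rewrite /unsign !map_cat -/(unsign a) -/(unsign b) -/(unsign p).
split.
- by rewrite !wprod_cat p1 mul1g.
- by move=> t; rewrite !refl_parity_cat pN p1 invg1 mulg1 mul1g.
- by rewrite !size_cat !oddD (negbTE p_even).
Qed.

End ParityInvariance.

(** * Expressions over a set of generators *)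

Section Expressions.
Context {W : groupType}.
Implicit Types (J : set W) (a b : seq W) (s t w x y : W).

Lemma subgroup_gen_mem J s : J s -> subgroup_gen J s.
Proof. by move=> Js H [_]; apply. Qed.

Lemma subgroup_genS J J' w : J `<=` J' -> subgroup_gen J w -> subgroup_gen J' w.
Proof. by move=> JJ' Jw H [Hgrp HJ']; apply: Jw; split=> // s /JJ' /HJ'. Qed.

Lemma subgroup_gen1 J : subgroup_gen J 1.
Proof. by move=> H [[H1 _] _]; rewrite inE in H1. Qed.

Lemma subgroup_gen_div J x y :
  subgroup_gen J x -> subgroup_gen J y -> subgroup_gen J (x * y^-1).
Proof.
move=> Jx Jy H HJ; have [[_ Hdiv] _] := HJ.
have /Hdiv H' : x \in mem H by rewrite inE; apply: Jx.
have /H' : y \in mem H by rewrite inE; apply: Jy.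
by rewrite inE.
Qed.

Lemma subgroup_genV J x : subgroup_gen J x -> subgroup_gen J x^-1.
Proof. by move=> Jx; rewrite -[x^-1]mul1g; 
  exact: (subgroup_gen_div (@subgroup_gen1 J) Jx). Qed.

Lemma subgroup_genM J x y :
  subgroup_gen J x -> subgroup_gen J y -> subgroup_gen J (x * y).
Proof. by move=> Jx Jy; rewrite -[y]invgK; 
  exact: (subgroup_gen_div Jx (subgroup_genV Jy)). Qed.

Lemma subgroup_gen_wprod J a : (forall x, x \in a -> J x) -> subgroup_gen J (wprod a).
Proof.
elim: a => [|x a IH] aJ; first by rewrite wprod_nil; apply: subgroup_gen1.
rewrite wprod_cons; apply: subgroup_genM.
  by apply: subgroup_gen_mem; apply: aJ; rewrite mem_head.
by apply: IH => y ya; apply: aJ; rewrite inE ya orbT.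
Qed.

Lemma length_le_size J w a : is_expression J w a -> length J w <= size a.
Proof.
by move=> wa; rewrite /length; case: xgetP => // n _ [_]; apply.
Qed.

Section Involutions.
Variable J : set W.
Hypothesis J_inv : forall s, J s -> s * s = 1.

Lemma subgroup_gen_expression w : subgroup_gen J w -> exists a, is_expression J w a.
Proof.
pose H := [set w | exists a, is_expression J w a].
suff HJ : group_closed (mem H) /\ J `<=` H by move=> /(_ H HJ).
split; last first.
  move=> s Js; exists [:: s]; split; last exact: big_seq1.
  by move=> x; rewrite inE => /eqP ->.
split; first by rewrite inE; exists [::]; split=> //; rewrite big_nil.
move=> x y; rewrite !inE => -[a [aJ <-]] [b [bJ <-]]; exists (a ++ rev b).
split=> [z|]; first by rewrite mem_cat mem_rev => /orP[/aJ|/bJ].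
rewrite -[LHS]/(wprod _) wprod_cat wprod_rev // => z zb.
exact/J_inv/bJ.
Qed.

Lemma reduced_expression w : subgroup_gen J w ->
  exists2 a, is_expression J w a & size a = length J w.
Proof.
move=> /subgroup_gen_expression[a wa].
pose P n := `[< exists2 b, is_expression J w b & size b = n >].
have Pex : exists n, P n by exists (size a); apply/asboolP; exists a.
suff [] : [set n | (exists2 b, is_expression J w b & size b = n) /\
   forall b, is_expression J w b -> n <= size b] (length J w) by [].
apply: xgetPex; case: (ex_minnP Pex) => n /asboolP Pn n_min; exists n.
by split=> // b wb; apply: n_min; apply/asboolP; exists b.
Qed.

End Involutions.
End Expressions.

(** * Length and exchange in Coxeter groups *)

Section CoxeterGroup.
Context {W : groupType}.
Variables (S : set W) (m : W -> W -> option nat).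
Hypothesis cox : coxeter_system S m.
Implicit Types (J : set W) (a b : seq W) (s t w x y z : W).

Local Notation "'l( w )" := (length S w).

Lemma coxeter_order s t k : S s -> S t -> m s t = Some k -> (s * t) ^+ k = 1.
Proof.
move=> Ss St mst; have [_ pres] := coxeter_presentation cox.
pose p : signed_word := flatten (nseq k [:: (s, false); (t, false)]).
have pS (x : W * bool) : x \in p -> S x.1.
  rewrite /p; elim: k {mst p} => [|k IH] //=; rewrite !inE.
  by move=> /or3P[/eqP ->|/eqP ->|/IH].
have p1 : word_equiv S (coxeter_relators S m) p [::].
  have Rp : coxeter_relators S m p by exists s, t, k.
  by have := word_equiv_relator S [::] [::] Rp; rewrite cats0.
rewrite -wprod_alternating -[RHS](proj2 (pres p pS) p1) word_valE.
by congr wprod; rewrite /p; elim: k {mst p pS p1} => //= k <-.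
Qed.

Lemma coxeter_involution s : S s -> s * s = 1.
Proof. by move=> Ss; have := coxeter_order Ss Ss (coxeter_diag cox Ss). Qed.
Hint Resolve coxeter_involution : core.

Lemma coxeter_inv s : S s -> s^-1 = s.
Proof. by move=> Ss; apply: (mulgI s); rewrite mulgV coxeter_involution. Qed.

Lemma coxeter_trivial_word a : (forall x, x \in a -> S x) -> wprod a = 1 ->
  (forall t, refl_parity a t = false) /\ odd (size a) = false.
Proof.
move=> aS a1; have [_ pres] := coxeter_presentation cox.
pose sa : signed_word := [seq (x, false) | x <- a].
have unsign_sa : unsign sa = a by rewrite /unsign -map_comp map_id.
have sa_S (x : W * bool) : x \in sa -> S x.1 by move=> /mapP[y /aS Sy ->].
have sa1 : word_val sa = 1 by rewrite word_valE unsign_sa.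
have relator_trivial p : coxeter_relators S m p -> wprod (unsign p) = 1 /\
    (forall t, refl_parity (unsign p) t = false) /\ ~~ odd (size p).
  move=> [s [t [k [Ss St mst ->]]]].
  have -> : unsign (flatten (nseq k [:: (s, false); (t, false)]))
      = flatten (nseq k [:: s; t]) by elim: (k) => //= j <-.
  rewrite wprod_alternating (coxeter_order Ss St mst); split=> //; split.
    by move=> r; rewrite refl_parity_relator ?coxeter_involution // coxeter_order.
  by elim: (k) => //= j; rewrite negbK.
have [_ par] := word_equiv_invariants coxeter_involution relator_trivial
  (proj1 (pres _ sa_S) sa1).
by rewrite unsign_sa in par; rewrite size_map.
Qed.

(** If a and b represent the same element, then a followed by the reverse of b
represents 1, and so does b followed by its reverse; comparing the parities of
these two trivial words cancels the contribution of the reverse of b. *)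
Lemma coxeter_word_invariants a b : (forall x, x \in a -> S x) ->
    (forall x, x \in b -> S x) -> wprod a = wprod b ->
  refl_parity a =1 refl_parity b /\ odd (size a) = odd (size b).
Proof.
move=> aS bS ab.
have trivial c : (forall x, x \in c -> S x) -> wprod c = wprod b ->
    (forall t, refl_parity (c ++ rev b) t = false) /\
    odd (size (c ++ rev b)) = false.
  move=> cS cb; apply: coxeter_trivial_word.
    by move=> x; rewrite mem_cat mem_rev => /orP[/cS|/bS].
  by rewrite wprod_cat wprod_rev ?cb ?mulgV // => x /bS /coxeter_involution.
have [Na odda] := trivial a aS ab; have [Nb oddb] := trivial b bS erefl.
split=> [t|].
  have := Na t; have := Nb t; rewrite !refl_parity_cat ab.
  by do 3![case: refl_parity].
by move: odda oddb; rewrite !size_cat !oddD; do 3![case: odd].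
Qed.

Lemma coxeter_gen w : subgroup_gen S w.
Proof. by have [-> _] := coxeter_presentation cox. Qed.
Hint Resolve coxeter_gen : core.

Lemma coxeter_reduced w : exists a, [/\ forall x, x \in a -> S x, wprod a = w &
  size a = 'l(w)].
Proof.
by have [a [aS aw] sz_a] := reduced_expression coxeter_involution (coxeter_gen w);
  exists a.
Qed.

Lemma length_wprod a : (forall x, x \in a -> S x) -> 'l(wprod a) <= size a.
Proof. by move=> aS; apply: length_le_size. Qed.

Lemma odd_length_wprod a : (forall x, x \in a -> S x) ->
  odd 'l(wprod a) = odd (size a).
Proof.
move=> aS; have [b [bS ba <-]] := coxeter_reduced (wprod a).
by have [_ ->] := coxeter_word_invariants bS aS ba.
Qed.

Lemma length1 : 'l(1 : W) = 0.
Proof.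
by apply/eqP; rewrite -leqn0 -wprod_nil; apply: length_wprod => x; rewrite in_nil.
Qed.

Lemma length_eq0 w : 'l(w) = 0 -> w = 1.
Proof.
by have [a [_ <- <-]] := coxeter_reduced w => /size0nil ->; rewrite wprod_nil.
Qed.

Lemma lengthM x y : 'l(x * y) <= 'l(x) + 'l(y).
Proof.
have [a [aS <- <-]] := coxeter_reduced x; have [b [bS <- <-]] := coxeter_reduced y.
rewrite -size_cat -wprod_cat; apply: length_wprod => z.
by rewrite mem_cat => /orP[/aS|/bS].
Qed.

Lemma odd_lengthM x y : odd 'l(x * y) = odd ('l(x) + 'l(y)).
Proof.
have [a [aS <- <-]] := coxeter_reduced x; have [b [bS <- <-]] := coxeter_reduced y.
rewrite -size_cat -wprod_cat; apply: odd_length_wprod => z.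
by rewrite mem_cat => /orP[/aS|/bS].
Qed.

Lemma lengthV w : 'l(w^-1) = 'l(w).
Proof.
suff le x : 'l(x^-1) <= 'l(x) by apply/eqP; rewrite eqn_leq le -{1}(invgK w) le.
have [a [aS <- <-]] := coxeter_reduced x.
rewrite -wprod_rev; last by move=> y /aS /coxeter_involution.
by rewrite -(size_rev a); apply: length_wprod => y; rewrite mem_rev; apply: aS.
Qed.

Lemma length_mulVg_gen w s : S s -> 'l(w^-1 * s) = 'l(s * w).
Proof. by move=> Ss; rewrite -(lengthV (s * w)) invgM (coxeter_inv Ss). Qed.

Lemma length_mulgV_gen w s : S s -> 'l(s * w^-1) = 'l(w * s).
Proof. by move=> Ss; rewrite -(lengthV (w * s)) invgM (coxeter_inv Ss). Qed.

Lemma length_gen s : S s -> 'l(s) = 1%N.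
Proof.
move=> Ss; have sS x : x \in [:: s] -> S x by rewrite inE => /eqP ->.
have := length_wprod sS; have := odd_length_wprod sS.
by rewrite wprod_cons wprod_nil mulg1 /=; case: length => [|[]].
Qed.

(** The parity of the length is a group homomorphism because all relators have
even length; hence multiplication by a generator changes the length. *)
Lemma length_mulr_gen w s : S s ->
  'l(w * s) = 'l(w).+1 \/ 'l(w) = 'l(w * s).+1.
Proof.
move=> Ss; have := lengthM w s; have := lengthM (w * s) s; have := odd_lengthM w s.
rewrite -mulgA coxeter_involution // mulg1 (length_gen Ss); lia.
Qed.

(** Some word of w starts with s and continues with a reduced word of sw. There s
occurs exactly once among the reflections, so its parity is odd; by invariance
it is odd for every word a of w, and s occurs among the reflections of a. *)
Lemma exchange_refl s w a : S s -> 'l(s * w) < 'l(w) ->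
  (forall x, x \in a -> S x) -> wprod a = w -> s \in refls a.
Proof.
move=> Ss lt_sw aS aw; have [b [bS bw sz_b]] := coxeter_reduced (s * w).
have sbS x : x \in s :: b -> S x by rewrite inE => /orP[/eqP ->|/bS].
have sbw : wprod (s :: b) = wprod a.
  by rewrite wprod_cons bw mulgA coxeter_involution ?mul1g.
have : refl_parity (s :: b) s.
  rewrite /refl_parity /= eqxx oddD /=; 
  case cnt: (count_mem s [seq s * y * s^-1 | y <- refls b]) => [|n] //.
  (* if s is a reflection of b, then w = s * wprod b is shorter than s * w *)
  exfalso.
  have: 0 < count_mem s [seq s * y * s^-1 | y <- refls b] by rewrite cnt.
  rewrite -has_count => /hasP[_ /mapP[y yb ->]] /eqP; rewrite -[RHS](mulgK s).
  move=> /mulIg /mulgI ys; rewrite ys in yb.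
  have b_inv x : x \in b -> x * x = 1 by move=> /bS /coxeter_involution.
  have [b1 [x [b2 [def_b sb]]]] := wprod_delete b_inv yb.
  have: 'l(w) <= size (b1 ++ b2).
    rewrite -aw -sbw wprod_cons sb; apply: length_wprod => z zb; apply: bS.
    by rewrite def_b; move: zb; rewrite !mem_cat inE => /orP[->|->] //; rewrite !orbT.
  move: sz_b lt_sw; rewrite def_b !size_cat /=; lia.
have [-> _] := coxeter_word_invariants sbS aS sbw.
rewrite /refl_parity => /odd_gt0; rewrite -has_count => /hasP[y ya /eqP <-].
exact: ya.
Qed.

Lemma left_exchange s w a : S s -> 'l(s * w) < 'l(w) ->
    (forall x, x \in a -> S x) -> wprod a = w ->
  exists a1 x a2, a = a1 ++ x :: a2 /\ s * w = wprod (a1 ++ a2).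
Proof.
move=> Ss lt_sw aS aw; rewrite -aw; apply: wprod_delete.
  by move=> x /aS /coxeter_involution.
exact: exchange_refl lt_sw aS aw.
Qed.

(** This is the left exchange for the reversed word. *)
Lemma right_exchange s w a : S s -> 'l(w * s) < 'l(w) ->
    (forall x, x \in a -> S x) -> wprod a = w ->
  exists a1 x a2, a = a1 ++ x :: a2 /\ w * s = wprod (a1 ++ a2).
Proof.
move=> Ss lt_ws aS aw.
have raS x : x \in rev a -> S x by rewrite mem_rev; apply: aS.
have raw : wprod (rev a) = w^-1.
  by rewrite wprod_rev ?aw // => x /aS /coxeter_involution.
have lt_sw : 'l(s * w^-1) < 'l(w^-1).
  by rewrite length_mulgV_gen // lengthV.
have [a1 [x [a2 [def_a sw]]]] := left_exchange Ss lt_sw raS raw.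
exists (rev a2), x, (rev a1); split.
  by rewrite -[a]revK def_a rev_cat rev_cons cat_rcons.
rewrite -[LHS]invgK invgM (coxeter_inv Ss) sw -rev_cat wprod_rev // => y ya.
apply/coxeter_involution/raS; rewrite def_a; move: ya.
by rewrite !mem_cat inE => /orP[->|->] //; rewrite !orbT.
Qed.

(** Deletion: build the word from right to left and apply the exchange condition
each time a letter fails to increase the length. Staying within subwords is what
keeps the letters inside a given parabolic subgroup. *)
Lemma reduced_subword a : (forall x, x \in a -> S x) ->
  exists b, [/\ subseq b a, wprod b = wprod a & size b = 'l(wprod a)].
Proof.
elim: a => [|x a IH] aS; first by exists [::]; rewrite wprod_nil length1.
have Sx : S x by apply: aS; rewrite mem_head.
have {}aS y : y \in a -> S y by move=> ya; apply: aS; rewrite inE ya orbT.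
have [b [ba b_a sz_b]] := IH aS; rewrite wprod_cons.
have bS y : y \in b -> S y by move=> /(mem_subseq ba) /aS.
have [|le_xa] := ltnP 'l(x * wprod a) 'l(wprod a); last first.
  exists (x :: b); rewrite /= eqxx wprod_cons b_a; split=> //.
  have := lengthM x (wprod a); have := odd_lengthM x (wprod a).
  rewrite (length_gen Sx); lia.
move=> lt_xa; have [b1 [y [b2 [def_b xb]]]] := left_exchange Sx lt_xa bS b_a.
have sub : subseq (b1 ++ b2) b.
  by rewrite def_b cat_subseq //; apply: subseq_cons.
exists (b1 ++ b2); split=> //.
  by apply: (subseq_trans (subseq_trans sub ba)); apply: subseq_cons.
have := lengthM x (x * wprod a); rewrite mulgA coxeter_involution // mul1g.
have b12S z : z \in b1 ++ b2 -> S z by move=> /(mem_subseq sub) /bS.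
have := length_wprod b12S; rewrite -xb (length_gen Sx).
move: sz_b; rewrite def_b !size_cat /=; lia.
Qed.

End CoxeterGroup.

(** * Parabolic subgroups and the weak order *)

Section Parabolic.
Context {W : groupType}.
Variables (S : set W) (m : W -> W -> option nat).
Hypothesis cox : coxeter_system S m.
Implicit Types (J : set W) (a b : seq W) (s t u w x y z : W).

Local Notation "'l( w )" := (length S w).
Local Notation D := (right_descents S).
Local Notation "u <=L w" := (weak_le S u w) (at level 70).

Lemma right_descents_gen w : D w `<=` S.
Proof. by move=> s []. Qed.

Section Subset.
Variable J : set W.
Hypothesis JS : J `<=` S.

Lemma parabolic_involution s : J s -> s * s = 1.
Proof. by move=> /JS; apply: (coxeter_involution cox). Qed.

(** A reduced word over S for an element of W_J can be found among the subwords
of any word over J. *)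
Lemma parabolic_length w : subgroup_gen J w -> length J w = 'l(w).
Proof.
move=> Jw; have [a [aJ aw] sz_a] := reduced_expression parabolic_involution Jw.
have aS x : x \in a -> S x by move=> /aJ /JS.
have [b [ba bw sz_b]] := reduced_subword cox aS.
rewrite -[LHS]/(wprod a) in aw; rewrite -[LHS]/(wprod b) aw in bw sz_b.
apply/eqP; rewrite eqn_leq -{1}sz_b -sz_a -aw length_wprod // andbT sz_a.
apply: length_le_size; split; last exact: bw.
by move=> x /(mem_subseq ba) /aJ.
Qed.

Lemma parabolic_reduced w : subgroup_gen J w ->
  exists a, [/\ forall x, x \in a -> J x, wprod a = w & size a = 'l(w)].
Proof.
move=> Jw; have [a [aJ aw] sz_a] := reduced_expression parabolic_involution Jw.
by exists a; split=> //; rewrite sz_a parabolic_length.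
Qed.

Lemma parabolic_gen s : S s -> subgroup_gen J s -> J s.
Proof.
move=> Ss /parabolic_reduced[a [aJ]]; rewrite (length_gen cox Ss).
case: a aJ => [|x [|]] //= aJ; rewrite wprod_cons wprod_nil mulg1 => <- _.
by apply: aJ; rewrite mem_head.
Qed.

Lemma parabolic_descents w : subgroup_gen J w -> D w `<=` J.
Proof.
move=> Jw s [Ss lt_ws]; have [a [aJ aw _]] := parabolic_reduced Jw.
have aS x : x \in a -> S x by move=> /aJ /JS.
have [a1 [x [a2 [def_a ws]]]] := right_exchange cox Ss lt_ws aS aw.
apply: parabolic_gen => //; rewrite -[s](mulKg w) ws.
apply: (subgroup_genM (subgroup_genV Jw)); apply: subgroup_gen_wprod => y ya.
apply: aJ; rewrite def_a; move: ya; rewrite !mem_cat inE.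
by move=> /orP[->|->] //; rewrite !orbT.
Qed.

(** The order on W_J only involves the length on S, so it is the restriction of
the weak order of W. Taking J = S gives the usual description of that order. *)
Lemma weak_le_parabolic u w : subgroup_gen J u ->
  weak_le J u w <-> subgroup_gen J w /\ 'l(w) = ('l(w * u^-1) + 'l(u))%N.
Proof.
move=> Ju; split=> [[s [sJ def_w len_s]]|[Jw len_w]].
  have rsJ x : x \in rev s -> J x by rewrite mem_rev; apply: sJ.
  have Jw : subgroup_gen J w.
    by rewrite def_w; apply: (subgroup_genM _ Ju); apply: subgroup_gen_wprod.
  split=> //; have := len_s _ (leqnn _); rewrite take_size -def_w.
  rewrite !parabolic_length // => len_w.
  have := lengthM cox (w * u^-1) u; rewrite mulgVK.
  have : 'l(w * u^-1) <= size s.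
    rewrite def_w mulgK -size_rev; apply: length_wprod => x /rsJ; exact: JS.
  lia.
have [a [aJ aw sz_a]] := parabolic_reduced (subgroup_gen_div Jw Ju).
exists (rev a); split.
- by move=> x; rewrite mem_rev; apply: aJ.
- by rewrite revK -[X in X * _]/(wprod a) aw mulgVK.
move=> j le_j; rewrite -[X in length J (X * _)]/(wprod _).
rewrite size_rev in le_j; set p := wprod _.
rewrite take_rev revK in p *; pose q := wprod (take (size a - j) a).
have qp : q * p = w * u^-1 by rewrite -wprod_cat cat_take_drop.
have pJ x : x \in drop (size a - j) a -> J x by move=> /mem_drop /aJ.
have qJ x : x \in take (size a - j) a -> J x by move=> /mem_take /aJ.
have Jp : subgroup_gen J p by apply: subgroup_gen_wprod.
rewrite !parabolic_length //; last exact: (subgroup_genM Jp Ju).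
have := lengthM cox p u; have := lengthM cox q (p * u).
rewrite mulgA qp mulgVK len_w -sz_a.
have : 'l(p) <= j.
  have := length_wprod (fun x xa => JS (pJ x xa)); rewrite size_drop -/p; lia.
have := length_wprod (fun x xa => JS (qJ x xa)).
rewrite size_take_min -/q; lia.
Qed.

(** If all of J descends from y, then y can be written with any reduced J-word
at its end: a letter deleted by the exchange condition cannot be one of the
reduced J-word, so it belongs to the complementary prefix. *)
Lemma descents_suffix y a : J `<=` D y -> (forall x, x \in a -> J x) ->
  size a = 'l(wprod a) -> ('l(y * (wprod a)^-1) + size a)%N = 'l(y).
Proof.
move=> JD; elim/last_ind: a => [|a x IH] axJ.
  by rewrite wprod_nil invg1 mulg1 addn0.
have Jx : J x by apply: axJ; rewrite mem_rcons mem_head.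
have aJ z : z \in a -> J z by move=> za; apply: axJ; rewrite mem_rcons inE za orbT.
rewrite wprod_rcons size_rcons => red_ax.
have aS z : z \in a -> S z by move=> /aJ /JS.
have red_a : size a = 'l(wprod a).
  have := length_wprod aS; have := lengthM cox (wprod a) x.
  rewrite -red_ax (length_gen cox (JS Jx)); lia.
have {IH} IH := IH aJ red_a.
have [c [cS c_ya sz_c]] := coxeter_reduced cox (y * (wprod a)^-1).
have cay : wprod (c ++ a) = y by rewrite wprod_cat c_ya mulgVK.
have caS z : z \in c ++ a -> S z by rewrite mem_cat => /orP[/cS|/aS].
have [Sx lt_yx] := JD x Jx.
have [a1 [z [a2 [def_ca yx]]]] := right_exchange cox Sx lt_yx caS cay.
have -> : y * (wprod a * x)^-1 = wprod (a1 ++ a2) * (wprod a)^-1.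
  by rewrite -yx invgM (coxeter_inv cox Sx) mulgA.
(* the deleted letter z lies either in c or in a *)
have [lt_a1|ge_a1] := ltnP (size a1) (size c).
  have def_c : c = a1 ++ z :: take (size c - (size a1).+1) a2.
    have := congr1 (take (size c)) def_ca; rewrite take_size_cat // => {1}->.
    rewrite take_cat ltnNge (ltnW lt_a1) /=.
    by case: (size c - size a1) (subnSK lt_a1) => //= n [->].
  have def_a2 : a2 = take (size c - (size a1).+1) a2 ++ a.
    move: def_ca; rewrite {1}def_c -catA => /eqP; rewrite eqseq_cat // => /andP[_].
    by rewrite /= => /eqP[].
  have c'S v : v \in a1 ++ take (size c - (size a1).+1) a2 -> S v.
    move=> v_c; apply: cS; rewrite def_c; move: v_c; rewrite !mem_cat inE.
    by move=> /orP[->|->] //; rewrite !orbT.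
  have := length_wprod c'S; have := congr1 size def_c.
  have := lengthM cox (y * (wprod a * x)^-1) (wprod a * x); rewrite mulgVK.
  rewrite invgM (coxeter_inv cox Sx) mulgA yx -red_ax.
  rewrite def_a2 !catA wprod_cat mulgK -def_a2 !size_cat /=; lia.
(* if z lies in a, then a x has a word shorter than a, but a x is reduced *)
exfalso; have def_a1 : a1 = c ++ drop (size c) a1.
  have := congr1 (take (size c)) def_ca; rewrite take_size_cat // take_cat.
  case: ltngtP ge_a1 => //= [_ _ def_c|eq_sz _].
    by rewrite {1}def_c cat_take_drop.
  by rewrite -eq_sz subnn take0 cats0 eq_sz => ->; rewrite drop_size cats0.
move: def_ca yx; rewrite def_a1; set b := drop _ _ => def_ca.
have def_a : a = b ++ z :: a2.
  by move/eqP: def_ca; rewrite -catA eqseq_cat // => /andP[_ /eqP].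
rewrite -cay -catA 2!wprod_cat -mulgA => /mulgI ax.
have ba2S v : v \in b ++ a2 -> S v.
  move=> v_b; apply: aS; rewrite def_a; move: v_b; rewrite !mem_cat inE.
  by move=> /orP[->|->] //; rewrite !orbT.
have := length_wprod ba2S; rewrite -ax -red_ax def_a !size_cat /=; lia.
Qed.

End Subset.

Lemma weak_leP u w : u <=L w <-> 'l(w) = ('l(w * u^-1) + 'l(u))%N.
Proof.
rewrite weak_le_parabolic //; last exact: (coxeter_gen cox).
by split=> [[]|->] //; split=> //; apply: (coxeter_gen cox).
Qed.

Lemma weak_le_length u w : u <=L w -> 'l(u) <= 'l(w).
Proof. by move=> /weak_leP ->; apply: leq_addl. Qed.

Lemma weak_le_refl w : w <=L w.
Proof. by apply/weak_leP; rewrite mulgV length1. Qed.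

Lemma weak_le_eq u w : u <=L w -> 'l(w) <= 'l(u) -> u = w.
Proof.
move=> /weak_leP len le_wu; apply: (mulIg u^-1); rewrite mulgV; apply: esym.
apply: (length_eq0 cox); lia.
Qed.

Lemma weak_le_trans u w v : u <=L w -> w <=L v -> u <=L v.
Proof.
move=> /weak_leP uw /weak_leP wv; apply/weak_leP.
have vu : (v * w^-1) * (w * u^-1) = v * u^-1 by rewrite mulgA mulgVK.
have := lengthM cox (v * u^-1) u; have := lengthM cox (v * w^-1) (w * u^-1).
rewrite vu mulgVK; lia.
Qed.

Lemma weak_le1 w : 1 <=L w.
Proof. by apply/weak_leP; rewrite invg1 mulg1 length1 addn0. Qed.

(** The intermediate element is s u, where s is the last letter of a reduced word
of w u^-1. *)
Lemma weak_le_step u w : u <=L w -> 'l(u) < 'l(w) ->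
  exists z, [/\ u <=L z, z <=L w & 'l(z) = 'l(u).+1].
Proof.
move=> /weak_leP; have [a [aS a_w <-]] := coxeter_reduced cox (w * u^-1).
case/lastP: a => [|a s] in aS a_w * => len_w lt_uw.
  by move: lt_uw; rewrite len_w ltnn.
have Ss : S s by apply: aS; rewrite mem_rcons mem_head.
have aS' y : y \in a -> S y by move=> ya; apply: aS; rewrite mem_rcons inE ya orbT.
have a_ws : w * (s * u)^-1 = wprod a.
  by rewrite invgM mulgA -a_w wprod_rcons mulgK.
have len_a := length_wprod aS'.
have len_su := lengthM cox s u; rewrite (length_gen cox Ss) in len_su.
have len_w' := lengthM cox (w * (s * u)^-1) (s * u).
rewrite mulgVK a_ws in len_w'; rewrite size_rcons in len_w.
exists (s * u).
by split; try apply/weak_leP; rewrite ?mulgK ?a_ws ?(length_gen cox Ss); lia.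
Qed.

(** Both sides say that the lengths of w t^-1, t u^-1 and u add up to that of w. *)
Lemma weak_interval_translate u w t : u <=L w ->
  weak_interval S u w t <-> t * u^-1 <=L w * u^-1.
Proof.
move=> /weak_leP uw.
have tu : (w * u^-1) * (t * u^-1)^-1 = w * t^-1 by rewrite invgM invgK mulgA mulgVK.
split=> [[/weak_leP ut /weak_leP tw]|/weak_leP].
  by apply/weak_leP; rewrite tu; lia.
rewrite tu => len; have := lengthM cox (t * u^-1) u; have := lengthM cox (w * t^-1) t.
by rewrite !mulgVK => *; split; apply/weak_leP; lia.
Qed.

Lemma right_descents_homo u w : u <=L w -> D u `<=` D w.
Proof.
move=> /weak_leP uw s [Ss lt_us]; split=> //.
have ws : (w * u^-1) * (u * s) = w * s by rewrite mulgA mulgVK.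
have := lengthM cox (w * u^-1) (u * s); rewrite ws; lia.
Qed.

(** This is the source of the top elements: W_J is bounded in the weak order as
soon as J consists of descents of a single element. *)
Lemma descents_weak_le J x y : J `<=` D y -> subgroup_gen J x -> x <=L y.
Proof.
move=> JD Jx; have JS : J `<=` S by move=> s /JD[].
have [a [aJ <- sz_a]] := parabolic_reduced JS Jx.
by apply/weak_leP; rewrite -sz_a (descents_suffix JS JD aJ).
Qed.

(** A reduced word of w is a reduced word of w x^-1 followed by one of x. Its
letters can be removed from the left: the first letter is a left descent of an
element of W_J, hence lies in J. *)
Lemma weak_le_subgroup_gen J x w : J `<=` S ->
  x <=L w -> subgroup_gen J w -> subgroup_gen J x.
Proof.
move=> JS /weak_leP; have [a [aS + <-]] := coxeter_reduced cox (w * x^-1).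
elim: a w aS => [|s a IH] w aS.
  by rewrite wprod_nil => w1 _; rewrite -[x]mul1g w1 mulgVK.
have Ss : S s by apply: aS; rewrite mem_head.
have aS' y : y \in a -> S y by move=> ya; apply: aS; rewrite inE ya orbT.
rewrite wprod_cons /= => def_w len_w Jw.
have sw : wprod a = s * w * x^-1.
  by rewrite -mulgA -def_w mulgA (coxeter_involution cox Ss) mul1g.
have := lengthM cox (s * w * x^-1) x; rewrite mulgVK -sw => len_sw.
have len_a := length_wprod aS'.
have ssw : s * (s * w) = w by rewrite mulgA (coxeter_involution cox Ss) mul1g.
have len_w' := lengthM cox s (s * w); rewrite ssw (length_gen cox Ss) in len_w'.
have Js : J s.
  apply: (parabolic_descents JS (subgroup_genV Jw)); split=> //.
  by rewrite (length_mulVg_gen cox) // (lengthV cox); lia.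
apply: (IH (s * w)) => //; first by lia.
by apply: (subgroup_genM _ Jw); apply: (subgroup_gen_mem Js).
Qed.

Lemma no_descents w : D w = set0 -> w = 1.
Proof.
move=> Dw; have [a [aS aw sz_a]] := coxeter_reduced cox w.
case/lastP: a => [|a s] in aS aw sz_a; first by rewrite -aw wprod_nil.
suff : D w s by rewrite Dw.
have Ss : S s by apply: aS; rewrite mem_rcons mem_head.
split=> //; rewrite -sz_a size_rcons ltnS -aw wprod_rcons -mulgA.
rewrite (coxeter_involution cox Ss) mulg1; apply: length_wprod => x xa.
by apply: aS; rewrite mem_rcons inE xa orbT.
Qed.

Lemma top_element_unique J x : subgroup_gen J x -> J `<=` D x -> top_element J = x.
Proof.
move=> Jx JDx; have JS : J `<=` S by move=> s /JDx[].
have top y : subgroup_gen J y -> weak_le J y x.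
  move=> Jy; apply/weak_le_parabolic=> //; split=> //.
  exact/weak_leP/(descents_weak_le JDx Jy).
apply: xget_unique => // y [Jy topy].
have /weak_le_parabolic[//|//|_ /weak_leP xy] := topy x Jx.
have /weak_le_length yx := descents_weak_le JDx Jy.
by rewrite (weak_le_eq xy yx).
Qed.

Section TopElement.
Variables (J : set W) (y : W).
Hypothesis JDy : J `<=` D y.

(** The lengths on W_J are bounded by that of y, and an element of maximal length
in W_J has all of J among its descents. *)
Lemma top_element_spec : subgroup_gen J (top_element J) /\ J `<=` D (top_element J).
Proof.
have JS : J `<=` S by move=> s /JDy[].
pose P n := `[< exists2 x, subgroup_gen J x & 'l(x) = n >].
have Pex : exists n, P n.
  by exists 'l(1 : W); apply/asboolP; exists 1 => //; apply: subgroup_gen1.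
have Pmax n : P n -> n <= 'l(y).
  by move=> /asboolP[x Jx <-]; apply/weak_le_length/(descents_weak_le JDy).
case: (ex_maxnP Pex Pmax) => n /asboolP[x Jx len_x] n_max.
have JDx : J `<=` D x.
  move=> s Js; have Ss := JS s Js; split=> //.
  have : P 'l(x * s).
    apply/asboolP; exists (x * s) => //; apply: (subgroup_genM Jx).
    exact: (subgroup_gen_mem Js).
  by move=> /n_max; have := length_mulr_gen cox x Ss; lia.
by rewrite (top_element_unique Jx JDx).
Qed.

Lemma subgroup_gen_top_element : subgroup_gen J (top_element J).
Proof. exact: top_element_spec.1. Qed.

Lemma right_descents_top_element : D (top_element J) = J.
Proof.
have JS : J `<=` S by move=> s /JDy[].
apply/seteqP; split; last exact: top_element_spec.2.
exact: (parabolic_descents JS subgroup_gen_top_element).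
Qed.

Lemma top_element_weak_le : top_element J <=L y.
Proof. exact: (descents_weak_le JDy subgroup_gen_top_element). Qed.

Lemma weak_le_top_element x : x <=L top_element J <-> subgroup_gen J x.
Proof.
have [Jw JDw] := top_element_spec; split=> [le_x|]; last exact: descents_weak_le.
by apply: weak_le_subgroup_gen le_x Jw => s /JDy[].
Qed.

End TopElement.

(** S may be infinite, but the left descents of w occur among the finitely many
reflections of any fixed word of w. *)
Lemma finite_left_descents w : finite_set [set s | S s /\ 'l(s * w) < 'l(w)].
Proof.
have [a [aS aw _]] := coxeter_reduced cox w.
apply: (sub_finite_set (B := [set` refls a])); last exact: finite_seq.
by move=> s [Ss lt_sw] /=; apply: (exchange_refl cox Ss lt_sw aS aw).
Qed.

Lemma finite_right_descents w : finite_set (D w).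
Proof.
apply: (sub_finite_set _ (finite_left_descents w^-1)) => s [Ss lt_ws].
by split=> //; rewrite (length_mulgV_gen cox) // (lengthV cox).
Qed.

(** Every x < w lies below s w for some left descent s of w. *)
Lemma finite_weak_le w : finite_set [set x | x <=L w].
Proof.
have [n] := ubnP 'l(w); elim: n w => // n IH w lt_w.
have fin : finite_set ([set w] `|` \bigcup_(s in [set s | S s /\ 'l(s * w) < 'l(w)])
    [set x | x <=L s * w]).
  rewrite finite_setU; split; first exact: finite_set1.
  apply: bigcup_finite => [|s [Ss lt_sw]]; first exact: finite_left_descents.
  by apply: IH; move: lt_w lt_sw => /=; lia.
apply: sub_finite_set fin => x /weak_leP xw.
have [a [aS awx sz_a]] := coxeter_reduced cox (w * x^-1).
case: a => [|s a] in aS awx sz_a.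
  left; rewrite /= -[x]mul1g -[w](mulgVK x); congr (_ * _).
  by rewrite -awx wprod_nil.
have Ss : S s by apply: aS; rewrite mem_head.
have aS' y : y \in a -> S y by move=> ya; apply: aS; rewrite inE ya orbT.
have swx : s * w * x^-1 = wprod a.
  by rewrite -mulgA -awx wprod_cons mulgA (coxeter_involution cox Ss) mul1g.
have len_a := length_wprod aS'.
have len_sw := lengthM cox (s * w * x^-1) x; rewrite mulgVK in len_sw.
have ssw : s * (s * w) = w by rewrite mulgA (coxeter_involution cox Ss) mul1g.
have len_w := lengthM cox s (s * w); rewrite ssw (length_gen cox Ss) in len_w.
rewrite -swx in len_a; rewrite /= in sz_a.
right; exists s; first by split=> //; lia.
by apply/weak_leP; lia.
Qed.

Lemma finite_weak_interval u w : finite_set (weak_interval S u w).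
Proof. by apply: sub_finite_set (finite_weak_le w) => t []. Qed.

End Parabolic.

(** * Maximal chains in graded intervals *)

Section GradedIntervals.
Context {T : choiceType}.
Variables (le : T -> T -> Prop) (rk : T -> nat).
Hypothesis le_refl : forall x, le x x.
Hypothesis le_trans : forall x y z, le x y -> le y z -> le x z.
Hypothesis rk_homo : forall x y, le x y -> rk x <= rk y.
Hypothesis rk_eq : forall x y, le x y -> rk y <= rk x -> x = y.
Hypothesis rk_step : forall x y, le x y -> rk x < rk y ->
  exists z, [/\ le x z, le z y & rk z = (rk x).+1].

Lemma maximal_chain_exists (P : set T) : exists C, is_maximal_chain le P C.
Proof.
have [F FP tot_F|C [chC Cmax]] := @Zorn_bigcup T (is_chain le P).
  split=> [x [C /FP[CP _]]|x y [C FC Cx] [D FD Dy]]; first exact: CP.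
  have [CD|DC] := tot_F C D FC FD.
    by have [_ tot_D] := FP D FD; apply: tot_D => //; apply: CD.
  by have [_ tot_C] := FP C FC; apply: tot_C => //; apply: DC.
exists C; split=> // D chD CD; apply: contrapT => neq_DC.
by apply: (Cmax D) => //; split=> // DC; apply: neq_DC; apply/seteqP.
Qed.

Variables u w : T.
Hypothesis le_uw : le u w.
Local Notation P := [set t | le u t /\ le t w].

Section MaximalChain.
Variable C : set T.
Hypothesis Cmax : is_maximal_chain le P C.

Lemma maximal_chain_comparable t : P t -> (forall c, C c -> le c t \/ le t c) -> C t.
Proof.
case: Cmax => -[CP tot_C] C_max Pt cmp_t.
suff <- : [set t] `|` C = C by left.
apply: C_max; last by move=> c Cc; right.
split=> [_ [->|/CP]|x y [->|Cx] [->|Cy]] //; first by left; apply: le_refl.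
- by have [] := cmp_t y Cy; [right|left].
- exact: cmp_t.
- exact: tot_C.
Qed.

(** A rank missing from a maximal chain could be filled by an element between two
consecutive members of the chain. *)
Lemma maximal_chain_ranks k : rk u <= k <= rk w -> exists2 c, C c & rk c = k.
Proof.
case: (Cmax) => -[CP tot_C] _ /andP[].
have Cu : C u.
  by apply: maximal_chain_comparable => [|c /CP[uc _]]; [split|right].
have Cw : C w.
  by apply: maximal_chain_comparable => [|c /CP[_ cw]]; [split|left].
elim: k => [|k IH]; first by rewrite leqn0 => /eqP rk_u _; exists u.
rewrite leq_eqVlt => /predU1P[rk_u _|le_uk lt_kw]; first by exists u.
have [c Cc rk_c] := IH le_uk (ltnW lt_kw).
(* d is the next element of the chain above c *)
pose above n := `[< exists2 d, C d & rk d = n /\ k < n >].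
have exA : exists n, above n by exists (rk w); apply/asboolP; exists w.
case: (ex_minnP exA) => n /asboolP[d Cd [rk_d lt_kn]] n_min.
have le_cd : le c d.
  by have [//|/rk_homo] := tot_C c d Cc Cd; rewrite rk_c rk_d leqNgt lt_kn.
have lt_cd : rk c < rk d by rewrite rk_c rk_d.
have [z [le_cz le_zd rk_z]] := rk_step le_cd lt_cd.
exists z; last by rewrite rk_z rk_c.
apply: maximal_chain_comparable.
  by have [uc _] := CP c Cc; have [_ dw] := CP d Cd; split; apply: le_trans; eauto.
move=> e Ce; have [le_ek|lt_ke] := leqP (rk e) k.
  left; apply: le_trans le_cz; have [//|le_ce] := tot_C e c Ce Cc.
  by rewrite (rk_eq le_ce) ?rk_c.
right; apply: (le_trans le_zd); have [//|le_ed] := tot_C d e Cd Ce.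
suff -> : e = d by [].
apply: (rk_eq le_ed); rewrite rk_d; apply: n_min; apply/asboolP.
by exists e.
Qed.

Lemma maximal_chain_card : (C #= `I_(rk w - rk u).+1)%card.
Proof.
case: (Cmax) => -[CP tot_C] _; pose h t := (rk t - rk u)%N.
have hC : h @` C = `I_(rk w - rk u).+1.
  apply/seteqP; split=> [_ [c /CP[uc cw] <-]|n lt_n] /=.
    by rewrite ltnS leq_sub2r // rk_homo.
  have [|c Cc rk_c] := @maximal_chain_ranks (n + rk u)%N.
    by move: lt_n (rk_homo le_uw) => /=; lia.
  by exists c; rewrite // /h rk_c addnK.
rewrite -hC; apply/card_esym/inj_card_eq => x y; rewrite !inE /h => Cx Cy eq_h.
have [ux _] := CP x Cx; have [uy _] := CP y Cy.
have := rk_homo ux; have := rk_homo uy => ? ?.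
have [le_xy|le_yx] := tot_C x y Cx Cy; first by apply: rk_eq => //; lia.
by apply/esym/rk_eq => //; lia.
Qed.

End MaximalChain.

Lemma poset_rank_interval : poset_rank le P = (rk w - rk u)%N.
Proof.
apply: xget_unique.
  by have [C Cmax] := maximal_chain_exists P; exists C => //; apply: maximal_chain_card.
move=> n [C /maximal_chain_card C_card Cn]; apply/eqP; rewrite -eqSS; apply/eqP.
by apply/card_eq_II; apply: card_eq_trans C_card; apply: card_esym.
Qed.

End GradedIntervals.

(** * Uniqueness of the Moebius function *)

Section Mobius.
Context {T : choiceType}.
Variables (le : T -> T -> Prop) (rk : T -> nat) (P : set T).
Hypothesis le_refl : forall x, le x x.
Hypothesis rk_eq : forall x y, le x y -> rk y <= rk x -> x = y.
Hypothesis P_fin : finite_set P.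

Lemma mobius_unique mu nu x y : is_mobius le P mu -> is_mobius le P nu ->
  P x -> P y -> le x y -> mu x y = nu x y.
Proof.
move=> mob_mu mob_nu Px; have [n] := ubnP (rk y).
elim: n y => // n IH y lt_yn Py xy.
have I_fin : finite_set [set t | [/\ P t, le x t & le t y]].
  by apply: sub_finite_set P_fin => t [].
have := mob_mu x y Px Py xy; rewrite -(mob_nu x y Px Py xy).
rewrite !(fsbigD1 y _ _ I_fin) //.
rewrite (eq_fsbigr (nu x)) => [|t]; first exact: addIr.
rewrite inE => -[[Pt xt ty] neq_ty]; apply: IH => //.
rewrite ltnS in lt_yn; apply: leq_trans lt_yn; rewrite ltnNge.
by apply/negP => /(rk_eq ty).
Qed.

Lemma mobiusE mu x y : is_mobius le P mu -> P x -> P y -> le x y ->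
  mobius le P x y = mu x y.
Proof.
move=> mob Px Py xy; apply: xget_unique => [|_ [nu mob_nu <-]].
  by exists mu.
exact: mobius_unique.
Qed.

End Mobius.

(** * Sums over subsets *)

Section PowersetSums.
Context {T : choiceType}.
Implicit Types (A B : {fset T}).
Local Open Scope ring_scope.

Lemma sum_fpowersetU (V : nmodType) A B (F : {fset T} -> V) : [disjoint A & B]%fset ->
  \sum_(J <- fpowerset (A `|` B)%fset) F J =
    \sum_(J <- fpowerset A) \sum_(J' <- fpowerset B) F (J `|` J')%fset.
Proof.
move=> /fdisjointP disAB; rewrite -(big_allpairs_dep (h := fun J J' => J `|` J')%fset).
apply: perm_big; apply: uniq_perm; first exact: fset_uniq.
  apply: allpairs_uniq; [exact: fset_uniq|exact: fset_uniq|].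
  move=> _ _ /allpairsP[[J J'] /= [JA J'B ->]] /allpairsP[[I I'] /= [IA I'B ->]] /=.
  rewrite !fpowersetE in JA J'B IA I'B => /fsetP eqU.
  congr pair; apply/fsetP => x; have := eqU x; rewrite !inE.
    case: (boolP (x \in A)) => [/disAB xB|xA].
      by rewrite !(contraNF (fsubsetP J'B x) xB, contraNF (fsubsetP I'B x) xB) !orbF.
    by rewrite (contraNF (fsubsetP JA x) xA) (contraNF (fsubsetP IA x) xA).
  case: (boolP (x \in A)) => [/disAB xB|xA].
    by rewrite !(contraNF (fsubsetP J'B x) xB, contraNF (fsubsetP I'B x) xB).
  by rewrite (contraNF (fsubsetP JA x) xA) (contraNF (fsubsetP IA x) xA).
move=> J; rewrite fpowersetE; apply/idP/allpairsP => [JAB|[[I I'] /= [IA I'B ->]]].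
  exists (J `&` A, J `&` B)%fset; rewrite /= !fpowersetE !fsubsetIr; split=> //.
  by rewrite -fsetIUr; apply/esym/fsetIidPl.
by rewrite !fpowersetE in IA I'B; rewrite fsetUSS.
Qed.

(** Adding or removing a fixed element x of A pairs off subsets with opposite
signs. *)
Lemma sum_fpowerset_sign A :
  \sum_(J <- fpowerset A) (-1) ^+ #|` J| = (A == fset0)%:R :> int.
Proof.
have [->|[x xA]] := fset_0Vmem A.
  by rewrite fpowerset0 big_seq_fset1 cardfs0 eqxx.
rewrite -(fsetD1K xA) sum_fpowersetU; last by rewrite fdisjoint1X !inE eqxx.
rewrite fpowerset1 big_fsetU1 /=; last first.
  by rewrite inE; apply/eqP => /fsetP/(_ x); rewrite !inE eqxx.
rewrite big_seq_fset1 -big_split /= big1_seq.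
  by case: eqP => // /fsetP/(_ x); rewrite !inE eqxx.
move=> J; rewrite fpowersetE => /fsubsetP JA.
rewrite fset0U cardfsU1 exprD; case: (boolP (x \in J)) => [/JA|_].
  by rewrite !inE eqxx.
by rewrite /= expr1 mulN1r subrr.
Qed.

End PowersetSums.

(** * Characteristic polynomials of relations that agree on the carrier *)

Section CharPolyCongruence.
Context {T : choiceType}.
Variables (le le' : T -> T -> Prop) (P : set T).
Hypothesis eq_le : forall x y, P x -> P y -> (le x y <-> le' x y).

Lemma eq_poset_rank Q : Q `<=` P -> poset_rank le Q = poset_rank le' Q.
Proof.
move=> QP; have eq_chain C : is_chain le Q C <-> is_chain le' Q C.
  split=> -[CQ tot_C]; split=> // x y Cx Cy; have := tot_C x y Cx Cy;
    by rewrite !eq_le //; apply/QP/CQ.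
rewrite /poset_rank; congr xget; apply/seteqP; split=> n [C [chC maxC] Cn];
  exists C => //; split=> [|D /eq_chain]; [exact/eq_chain| exact: maxC
  |exact/eq_chain| exact: maxC].
Qed.

Lemma eq_is_mobius mu : is_mobius le P mu <-> is_mobius le' P mu.
Proof.
have eq_I x y : P x -> P y -> [set t | [/\ P t, le x t & le t y]]
    = [set t | [/\ P t, le' x t & le' t y]].
  by move=> Px Py; apply/seteqP; split=> t [Pt xt ty]; split=> //; apply/eq_le.
split=> mob x y Px Py xy; have := mob x y Px Py; rewrite eq_I //; apply.
  by apply/eq_le.
by apply/eq_le.
Qed.

Lemma eq_characteristic_poly bot :
  characteristic_poly le P bot = characteristic_poly le' P bot.
Proof.
apply: eq_fsbigr => t; rewrite inE => Pt; rewrite (eq_poset_rank (@subset_refl _ P)).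
rewrite /rank (eq_poset_rank (Q := [set x | P x /\ le x t])); last by move=> x [].
have -> : [set x | P x /\ le x t] = [set x | P x /\ le' x t].
  by apply/seteqP; split=> x [Px xt]; split=> //; apply/eq_le.
congr (_ *: _)%R; rewrite /mobius; congr xget.
by apply/seteqP; split=> v [mu mob <-]; exists mu => //; apply/eq_is_mobius.
Qed.

End CharPolyCongruence.

(** * Products of disjoint parabolic subgroups *)

Section DirectProduct.
Context {W : groupType}.
Variables (S : set W) (m : W -> W -> option nat).
Hypothesis cox : coxeter_system S m.
Implicit Types (A B J : set W) (s t u w x y z : W).

Local Notation "'l( w )" := (length S w).
Local Notation D := (right_descents S).

Lemma subgroup_gen_commute1 J x :
  (forall s, J s -> s * x = x * s) -> forall y, subgroup_gen J y -> y * x = x * y.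
Proof.
move=> comJ; pose H := [set y | y * x = x * y].
suff HJ : group_closed (mem H) /\ J `<=` H by move=> y /(_ H HJ).
split=> //; split=> [|y z]; rewrite !inE /H /=; first by rewrite mulg1 mul1g.
move=> yx zx; rewrite mulgA -yx -!mulgA; congr (_ * _).
by apply: (mulIg z); rewrite mulgVK -mulgA -zx mulKg.
Qed.

Lemma subgroup_gen_commute A B : (forall s t, A s -> B t -> s * t = t * s) ->
  forall x y, subgroup_gen A x -> subgroup_gen B y -> x * y = y * x.
Proof.
move=> comAB x y Ax By; apply: (subgroup_gen_commute1 _ Ax) => s As.
apply/esym; apply: (subgroup_gen_commute1 _ By) => t Bt; exact/esym/comAB.
Qed.

Section Disjoint.
Variables A B : set W.
Hypothesis AS : A `<=` S.
Hypothesis BS : B `<=` S.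
Hypothesis disAB : forall s, A s -> ~ B s.

(** A descent of x lies in both alphabets, so x has no descents. *)
Lemma parabolic_disjoint x : subgroup_gen A x -> subgroup_gen B x -> x = 1.
Proof.
move=> Ax Bx; apply: (no_descents cox); apply/seteqP; split=> // s Ds.
exact: (disAB (parabolic_descents cox AS Ax Ds) (parabolic_descents cox BS Bx Ds)).
Qed.

(** A subword of the juxtaposition of a word over A and a word over B that keeps
the product keeps both factors, because W_A and W_B meet trivially; so if both
words are reduced, nothing can be deleted. *)
Lemma length_mul_disjoint x y : subgroup_gen A x -> subgroup_gen B y ->
  'l(x * y) = ('l(x) + 'l(y))%N.
Proof.
move=> Ax By; have [a [aA ax sz_a]] := parabolic_reduced cox AS Ax.
have [b [bB bx sz_b]] := parabolic_reduced cox BS By.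
have abS z : z \in a ++ b -> S z by rewrite mem_cat => /orP[/aA /AS|/bB /BS].
have [c [/subseqP[k sz_k def_c] c_ab sz_c]] := reduced_subword cox abS.
move: def_c; rewrite -(cat_take_drop (size a) k) mask_cat; last first.
  by rewrite size_take_min sz_k size_cat; apply/minn_idPl/leq_addr.
set a' := mask _ a; set b' := mask _ b => def_c.
have a'A z : z \in a' -> A z by move=> /mem_mask /aA.
have b'B z : z \in b' -> B z by move=> /mem_mask /bB.
rewrite wprod_cat ax bx in c_ab sz_c; rewrite def_c wprod_cat in c_ab.
have Aa' := subgroup_gen_wprod a'A; have Bb' := subgroup_gen_wprod b'B.
have eq_ab : x^-1 * wprod a' = y * (wprod b')^-1.
  apply: (mulgI x); apply: (mulIg (wprod b')).
  by rewrite mulgA mulgV mul1g c_ab -!mulgA mulVg mulg1.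
have x1 : x^-1 * wprod a' = 1.
  apply: parabolic_disjoint; first exact: (subgroup_genM (subgroup_genV Ax) Aa').
  rewrite eq_ab; exact: (subgroup_gen_div By Bb').
have xa' : wprod a' = x by apply: (mulgI x^-1); rewrite x1 mulVg.
have yb' : wprod b' = y by apply: (mulgI x); rewrite -{1}xa' c_ab.
have := length_wprod (fun z za => AS (a'A z za)).
have := length_wprod (fun z zb => BS (b'B z zb)).
have := lengthM cox x y; rewrite xa' yb' -sz_c def_c size_cat; lia.
Qed.

End Disjoint.

(** The product of the two top elements has every element of A and of B as a
descent, since it can be written with either factor on the right. *)
Lemma top_elementU A B y z : A `<=` D y -> B `<=` D z ->
    (forall s, A s -> ~ B s) -> (forall s t, A s -> B t -> s * t = t * s) ->
  'l(top_element (A `|` B)) = ('l(top_element A) + 'l(top_element B))%N.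
Proof.
move=> ADy BDz disAB comAB.
have AS : A `<=` S by move=> s /ADy[].
have BS : B `<=` S by move=> s /BDz[].
have [Aa ADa] := top_element_spec cox ADy; have [Bb BDb] := top_element_spec cox BDz.
have len_ab := length_mul_disjoint AS BS disAB Aa Bb.
rewrite -len_ab; congr length; apply: (top_element_unique cox) => [|s [As|Bs]].
- apply: subgroup_genM.
    by apply: (subgroup_genS _ Aa) => s; left.
  by apply: (subgroup_genS _ Bb) => s; right.
- rewrite (subgroup_gen_commute comAB Aa Bb).
  apply: (right_descents_homo cox _ (ADa s As)); apply/(weak_leP cox).
  by rewrite mulgK -(subgroup_gen_commute comAB Aa Bb) len_ab addnC.
apply: (right_descents_homo cox _ (BDb s Bs)); apply/(weak_leP cox).
by rewrite mulgK.
Qed.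

End DirectProduct.

(** * The characteristic polynomial of a weak interval *)

Section CharacteristicPolynomial.
Context {W : groupType}.
Variables (S : set W) (m : W -> W -> option nat).
Hypothesis cox : coxeter_system S m.
Implicit Types (J : set W) (s t u w x y z : W).

Local Notation "'l( w )" := (length S w).
Local Notation D := (right_descents S).
Local Notation "u <=L w" := (weak_le S u w) (at level 70).
Local Notation fD y := (fset_set (right_descents S y)).
Local Open Scope ring_scope.

Lemma right_descents_fsetK y : [set` fD y] = D y.
Proof. exact/fset_setK/(finite_right_descents cox). Qed.

Lemma fpowerset_descents y (J : {fset W}) : J \in fpowerset (fD y) -> [set` J] `<=` D y.
Proof.
rewrite fpowersetE => /fsubsetP JD s /JD.
by rewrite (in_fset_set (finite_right_descents cox y)) inE.
Qed.

(** An element x in the subgroup generated by its own descents is the top element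
of that subgroup, and those below y correspond to the subsets J of D y, with
J = D x. *)
Lemma sum_weak_le (V : nmodType) (F : W -> V) y :
    (forall x, ~ subgroup_gen (D x) x -> F x = 0) ->
  \sum_(x \in [set x | x <=L y]) F x =
    \sum_(J <- fpowerset (fD y)) F (top_element [set` J]).
Proof.
move=> F0; rewrite [RHS](fsbig_seq _ _ (fset_uniq _)).
rewrite -(fsbig_image _ (fun J : {fset W} => top_element [set` J])); last first.
  move=> J J' /mem_set; rewrite !inE => JD J'D /(congr1 D).
  have JDy := fpowerset_descents JD; have J'Dy := fpowerset_descents J'D.
  rewrite (right_descents_top_element cox JDy) (right_descents_top_element cox J'Dy).
  move=> eqJ; apply/fsetP => s; have /= eqs := congr1 (fun A : set W => A s) eqJ.
  by apply/idP/idP; rewrite eqs.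
apply/esym/fsbig_widen => [_ [J /= /fpowerset_descents JD <-]|x [/= xy notop] /=].
  exact: (top_element_weak_le cox JD).
apply: F0 => Dx; apply: notop; exists (fD x).
  rewrite /= fpowersetE; apply/fsubsetP => s.
  rewrite !(in_fset_set (finite_right_descents cox _)) !inE.
  exact: (right_descents_homo cox xy).
by rewrite right_descents_fsetK; apply: (top_element_unique cox).
Qed.

(** The value at (1, x) of the Moebius function; the condition says that x is the
top element of the parabolic subgroup generated by its descents. *)
Definition weak_mobius x : int :=
  if `[< subgroup_gen (D x) x >] then (-1) ^+ #|` fD x| else 0.

Lemma weak_mobius_top_element y (J : {fset W}) : [set` J] `<=` D y ->
  weak_mobius (top_element [set` J]) = (-1) ^+ #|` J|.
Proof.
move=> JD; rewrite /weak_mobius (right_descents_top_element cox JD) set_fsetK.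
by rewrite asboolT //; apply: (subgroup_gen_top_element cox JD).
Qed.

Lemma weak_interval_image u w : u <=L w ->
  weak_interval S u w = (fun z => z * u)%g @` [set z | z <=L (w * u^-1)%g].
Proof.
move=> uw; apply/seteqP; split=> [t /(weak_interval_translate cox t uw) tw|].
  by exists (t * u^-1)%g => //; rewrite mulgVK.
by move=> _ [z zw <-]; apply/(weak_interval_translate cox _ uw); rewrite mulgK.
Qed.

Lemma sum_weak_interval (V : nmodType) (F : W -> V) u w : u <=L w ->
  \sum_(t \in weak_interval S u w) F t =
    \sum_(z \in [set z | z <=L (w * u^-1)%g]) F (z * u)%g.
Proof.
move=> uw; rewrite weak_interval_image // fsbig_image // => x y _ _; exact: mulIg.
Qed.

(** After translation to the bottom element, the defining sum becomes the
alternating sum over the subsets of the descents of y x^-1. *)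
Lemma is_mobius_weak_interval u w :
  is_mobius (weak_le S) (weak_interval S u w) (fun x y => weak_mobius (y * x^-1)%g).
Proof.
move=> x y [ux xw] [uy yw] xy.
have -> : [set t | [/\ weak_interval S u w t, x <=L t & t <=L y]]
    = weak_interval S x y.
  apply/seteqP; split=> [t [_ xt ty]|t [xt ty]] //; split=> //.
  by split; [apply: (weak_le_trans cox ux) | apply: (weak_le_trans cox ty)].
rewrite sum_weak_interval //; under eq_fsbigr do rewrite mulgK.
rewrite sum_weak_le; last by move=> z nz; rewrite /weak_mobius asboolF.
under eq_big_seq => J JD do rewrite (weak_mobius_top_element (fpowerset_descents JD)).
rewrite sum_fpowerset_sign; congr (nat_of_bool _)%:R; apply/eqP/eqP => [D0|->].
  apply/esym/(mulIg x^-1)%g; rewrite mulgV; apply: (no_descents cox).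
  by rewrite -right_descents_fsetK D0; apply/seteqP; split=> s.
rewrite mulgV; apply/fsetP => s.
rewrite inE (in_fset_set (finite_right_descents cox _)).
by apply/negbTE/negP; rewrite inE => -[_]; rewrite length1.
Qed.

Lemma poset_rank_weak_interval u w : u <=L w ->
  poset_rank (weak_le S) (weak_interval S u w) = ('l(w) - 'l(u))%N.
Proof.
apply: (poset_rank_interval (rk := length S)).
- exact: (weak_le_refl cox).
- exact: (weak_le_trans cox).
- exact: (weak_le_length cox).
- exact: (weak_le_eq cox).
exact: (weak_le_step cox).
Qed.


Lemma chi_interval_sum u w : u <=L w ->
  chi_interval S u w =
    \sum_(J <- fpowerset (fD (w * u^-1)%g)) (-1) ^+ #|` J| *:
       'X^('l((w * u^-1)%g) - 'l(top_element [set` J])).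
Proof.
move=> uw; have uu := weak_le_refl cox u.
rewrite /chi_interval /characteristic_poly sum_weak_interval //.
pose v := (w * u^-1)%g.
transitivity (\sum_(z \in [set z | z <=L v])
    weak_mobius z *: ('X^('l(v) - 'l(z)) : {poly int})).
  apply: eq_fsbigr => z; rewrite inE /= => zv.
  have : weak_interval S u w (z * u)%g.
    by rewrite weak_interval_image //; exists z.
  move=> uzw; have [uz zw] := uzw; congr (_ *: 'X^_).
    rewrite (mobiusE (rk := length S) _ _ _ (@is_mobius_weak_interval u w)) ?mulgK //.
    - exact: (weak_le_refl cox).
    - exact: (weak_le_eq cox).
    - exact: (finite_weak_interval cox).
  rewrite poset_rank_weak_interval //.
  have -> : rank (weak_le S) (weak_interval S u w) (z * u)%g = 'l(z).
    rewrite /rank; have -> : [set x | weak_interval S u w x /\ x <=L (z * u)%g]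
        = weak_interval S u (z * u)%g.
      apply/seteqP; split=> [x [[ux xw] xz]|x [ux xz]] //; split=> //.
      by split=> //; apply: (weak_le_trans cox xz).
    rewrite poset_rank_weak_interval //; move/(weak_leP cox): uz => ->.
    by rewrite mulgK addnK.
  by move/(weak_leP cox): uw => ->; rewrite addnK.
rewrite sum_weak_le => [|z nz]; last by rewrite /weak_mobius asboolF // scale0r.
by apply: eq_big_seq => J JD; rewrite (weak_mobius_top_element (fpowerset_descents JD)).
Qed.

(** W_J is the set of elements below its top element, and its order is the
restriction of the weak order of W. *)
Lemma chi_parabolic_interval J y : J `<=` D y ->
  chi_parabolic J = chi_interval S 1%g (top_element J).
Proof.
move=> JDy; have JS : J `<=` S by move=> s /JDy[].
have -> : chi_interval S 1%g (top_element J)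
    = characteristic_poly (weak_le S) (subgroup_gen J) 1%g.
  congr characteristic_poly; apply/seteqP; split=> [x [_]|x Jx].
    exact: (weak_le_top_element cox JDy x).1.
  split; first exact: (weak_le1 cox).
  exact: (weak_le_top_element cox JDy x).2.
apply: eq_characteristic_poly => x z Jx Jz.
rewrite (weak_le_parabolic cox JS z Jx) (weak_leP cox).
by split=> [[]|].
Qed.

(** When A is contained in some D y, this is the characteristic polynomial of the
finite group W_A. *)
Definition chi_descents (A : {fset W}) : {poly int} :=
  \sum_(J <- fpowerset A) (-1) ^+ #|` J| *:
     'X^('l(top_element [set` A]) - 'l(top_element [set` J])).

Lemma chi_parabolicE (A : {fset W}) y : [set` A] `<=` D y ->
  chi_parabolic [set` A] = chi_descents A.
Proof.
move=> ADy; rewrite (chi_parabolic_interval ADy) chi_interval_sum;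
  last exact: (weak_le1 cox).
by rewrite invg1 mulg1 (right_descents_top_element cox ADy) set_fsetK.
Qed.

Lemma chi_descents0 : chi_descents fset0 = 1.
Proof.
by rewrite /chi_descents fpowerset0 big_seq_fset1 cardfs0 subnn scale1r.
Qed.

Lemma top_element_subset (A J : {fset W}) y : [set` A] `<=` D y -> (J `<=` A)%fset ->
  ('l(top_element [set` J]) <= 'l(top_element [set` A]))%N.
Proof.
move=> ADy /fsubsetP JA; have [_ ADA] := top_element_spec cox ADy.
apply/(weak_le_length cox)/(top_element_weak_le cox) => s /= /JA; exact: ADA.
Qed.

Lemma chi_descentsU (A B : {fset W}) y : [set` A] `<=` D y -> [set` B] `<=` D y ->
    [disjoint A & B]%fset ->
    (forall s t, s \in A -> t \in B -> (s * t = t * s)%g) ->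
  chi_descents (A `|` B)%fset = chi_descents A * chi_descents B.
Proof.
move=> ADy BDy disAB comAB.
have len_top (I J : {fset W}) : (I `<=` A)%fset -> (J `<=` B)%fset ->
    'l(top_element [set` (I `|` J)%fset])
      = ('l(top_element [set` I]) + 'l(top_element [set` J]))%N.
  move=> /fsubsetP IA /fsubsetP JB.
  have -> : [set` (I `|` J)%fset] = [set` I] `|` [set` J].
    by apply/seteqP; split=> s /=; rewrite in_fsetU => /orP.
  apply: (top_elementU cox (y := y) (z := y)).
  - by move=> s /= /IA; apply: ADy.
  - by move=> s /= /JB; apply: BDy.
  - by move=> s /= /IA sA /JB; apply/negP/(fdisjointP disAB).
  by move=> s t /= /IA sA /JB tB; apply: comAB.
rewrite /chi_descents sum_fpowersetU // mulr_suml; apply: eq_big_seq => I.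
rewrite fpowersetE => IA; rewrite mulr_sumr; apply: eq_big_seq => J.
rewrite fpowersetE => JB.
rewrite -scalerAl -scalerAr scalerA -exprD -exprD; congr (_ ^+ _ *: 'X^_).
  rewrite -cardfsUI; have -> : (I `&` J = fset0)%fset; last by rewrite cardfs0 addn0.
  apply/eqP; rewrite fsetI_eq0; apply/fdisjointP => s /(fsubsetP IA) sA.
  by apply: contra (fdisjointP disAB s sA); apply: fsubsetP.
rewrite !len_top //; have := top_element_subset ADy IA.
have := top_element_subset BDy JB; lia.
Qed.

Lemma chi_descents_bigcup (I : eqType) (A : I -> {fset W}) y (r : seq I) : uniq r ->
    (forall i, i \in r -> [set` A i] `<=` D y) ->
    (forall i j, i \in r -> j \in r -> i != j -> [disjoint A i & A j]%fset /\
       forall s t, s \in A i -> t \in A j -> (s * t = t * s)%g) ->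
  chi_descents (\bigcup_(i <- r) A i)%fset = \prod_(i <- r) chi_descents (A i).
Proof.
elim: r => [|i r IH] /=; first by rewrite !big_nil chi_descents0.
move=> /andP[i_r uniq_r] AD disA; rewrite !big_cons.
have neq_i j : j \in r -> i != j by apply: contraTneq => <-.
rewrite -IH //; first last.
- by move=> j k jr kr; apply: disA; rewrite inE ?jr ?kr orbT.
- by move=> j jr; apply: AD; rewrite inE jr orbT.
apply: (chi_descentsU (y := y)).
- by apply: AD; rewrite mem_head.
- by move=> s /= /bigfcupP[j /andP[jr _]]; apply: AD; rewrite inE jr orbT.
- apply/fdisjointP => s sA; apply/bigfcupP => -[j /andP[jr _]]; apply/negP.
  have jir : j \in i :: r by rewrite inE jr orbT.
  have [/fdisjointP disij _] := disA i j (mem_head _ _) jir (neq_i j jr).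
  exact: disij.
move=> s t sA /bigfcupP[j /andP[jr _] tA].
have jir : j \in i :: r by rewrite inE jr orbT.
have [_ comij] := disA i j (mem_head _ _) jir (neq_i j jr).
exact: comij.
Qed.

Lemma coxeter_edge_sym K s t : K `<=` S -> coxeter_edge m K s t -> coxeter_edge m K t s.
Proof.
move=> KS [Ks Kt neq_st mst]; split=> //; first exact: nesym.
by rewrite -(coxeter_sym cox (KS s Ks) (KS t Kt)).
Qed.

(** Without an edge m(s, t) = 2, and (st)^2 = 1 for involutions s and t means that
they commute. *)
Lemma non_edge_commute K s t : K `<=` S -> K s -> K t -> s <> t ->
  ~ coxeter_edge m K s t -> (s * t = t * s)%g.
Proof.
move=> KS Ks Kt neq_st nedge; have Ss := KS s Ks; have St := KS t Kt.
have [k mst lt_k3] : exists2 k, m s t = Some k & (k < 3)%N.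
  case mst : (m s t) => [k|]; last by case: nedge; split=> //; rewrite mst.
  exists k => //; rewrite ltnNge; apply/negP => le3k.
  by apply: nedge; split=> //; rewrite mst.
have k2 : k = 2 by have := coxeter_ge2 cox Ss St neq_st mst; lia.
have := coxeter_order cox Ss St mst; rewrite k2 expg2 => stst.
(* s t = (s t) (s t) (s t)^-1 = (s t)^-1 = t s *)
rewrite -[LHS](mulgK (s * t)%g) stst mul1g invgM.
by rewrite (coxeter_inv cox Ss) (coxeter_inv cox St).
Qed.

Lemma component_disjoint K C C' s : K `<=` S -> is_component m K C ->
  is_component m K C' -> C s -> C' s -> C = C'.
Proof.
move=> KS.
have sym x y : clos_refl_trans W (coxeter_edge m K) x y ->
    clos_refl_trans W (coxeter_edge m K) y x.
  elim=> [{}x {}y xy|{}x|{}x {}y z _ yx _ zy]; first exact/rt_step/coxeter_edge_sym.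
    exact: rt_refl.
  exact: rt_trans zy yx.
move=> [c Kc ->] [c' Kc' ->] /= cs c's.
by apply/seteqP; split=> t /= ct; [apply: (rt_trans _ _ _ _ _ c's)|
  apply: (rt_trans _ _ _ _ _ cs)]; apply: rt_trans ct; apply: sym.
Qed.

Lemma component_commute K C C' s t : K `<=` S -> is_component m K C ->
  is_component m K C' -> C <> C' -> K s -> K t -> C s -> C' t -> (s * t = t * s)%g.
Proof.
move=> KS compC compC' neqCC' Ks Kt Cs C't.
apply: (non_edge_commute KS Ks Kt) => [st|st].
  by apply/neqCC'/(component_disjoint KS compC compC' Cs); rewrite st.
apply/neqCC'/(component_disjoint KS compC compC' (s := t)) => //.
case: compC Cs => c Kc -> /= cs; apply: rt_trans cs _; exact: rt_step.
Qed.

End CharacteristicPolynomial.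

Theorem theorem3p5 (W : groupType) (S : set W) (m : W -> W -> option nat)
    (cox : coxeter_system S m) (u w : W) (le_uw : weak_le S u w)
    (r : nat) (K : 'I_r -> set W)
    (K_inj : injective K)
    (K_component : forall i,
       is_component m (right_descents S (w * u^-1)%g) (K i))
    (K_cover : (\bigcup_i K i)%classic = right_descents S (w * u^-1)%g) :
  (chi_interval S u w =
     'X^(length S (w * u^-1)%g
           - length S (top_element (right_descents S (w * u^-1)%g)))
     * \prod_(i < r) chi_parabolic (K i))%R.
Proof.
set v := w * u^-1 in K_component K_cover *.
pose Dv := right_descents S v; have DS : Dv `<=` S := @right_descents_gen _ S v.
have finD := finite_right_descents cox v.
have KD i : K i `<=` Dv by rewrite /Dv -K_cover => s Ks; exists i.
have K_fin i : [set` fset_set (K i)] = K i.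
  exact/fset_setK/(sub_finite_set (KD i)).
pose A i : {fset W} := fset_set (K i).
have in_A i s : s \in A i -> K i s.
  by rewrite -[is_true _]/([set` A i] s) K_fin.
have A_D i : [set` A i] `<=` Dv by rewrite K_fin.
have cup_A : (\bigcup_(i <- enum 'I_r) A i)%fset = fset_set Dv.
  apply/fsetP => s; rewrite (in_fset_set finD); apply/bigfcupP/idP.
    by move=> [i _ /in_A Ks]; rewrite inE; apply: (KD i).
  rewrite inE -K_cover => -[i _ Ks]; exists i; first by rewrite mem_enum.
  by rewrite -[is_true _]/([set` A i] s) K_fin.
have prodE : (\prod_(i < r) chi_parabolic (K i))%R = chi_descents S (fset_set Dv).
  rewrite -cup_A (chi_descents_bigcup cox (y := v)) ?enum_uniq //.
    rewrite big_enum; apply: eq_bigr => i _.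
    by rewrite -(chi_parabolicE cox (A_D i)) K_fin.
  move=> i j _ _ neq_ij; have neqK : K i <> K j.
    by move=> /K_inj eq_ij; rewrite eq_ij eqxx in neq_ij.
  split=> [|s t /in_A Ks /in_A Kt].
    apply/fdisjointP => s /in_A Ks; apply/negP => /in_A Kt; apply: neqK.
    exact: (component_disjoint cox DS (K_component i) (K_component j) Ks Kt).
  apply: (component_commute cox DS (K_component i) (K_component j) neqK) => //.
    exact: KD Ks.
  exact: KD Kt.
rewrite prodE (chi_interval_sum cox le_uw) -/v -/Dv /chi_descents mulr_sumr.
apply: eq_big_seq => J JD; rewrite -scalerAr -exprD fset_setK //.
have ADv : [set` fset_set Dv] `<=` right_descents S v by rewrite fset_setK.
have lt_J := top_element_subset cox ADv; rewrite fpowersetE in JD.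
have := lt_J _ JD; rewrite fset_setK // => le_J.
have le_D := weak_le_length cox (top_element_weak_le cox (@subset_refl _ Dv)).
congr (_ *: 'X^_)%R; lia.
Qed.
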